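(* The matrix of any anti-Rota-Baxter operator on the Lie algebra $sl_2(\mathbb{C})$, in the basis $\{e_1,e_2,e_3\}$, has one of the following forms (all parameters in $\mathbb{C}$): $$\text{(1)}\ \begin{pmatrix}0&0&0\\ d&0&0\\ 0&0&m\end{pmatrix},\quad \text{(2)}\ \begin{pmatrix}0&0&0\\ d&0&h\\ 0&0&0\end{pmatrix}\ (h\neq 0),\quad \text{(3)}\ \begin{pmatrix}0&b&c\\ 0&0&0\\ 0&0&0\end{pmatrix}\ (c\neq 0),$$ $$\text{(4)}\ \begin{pmatrix}0&b&0\\ 0&0&0\\ 0&0&m\end{pmatrix}\ (b\neq 0),\quad \text{(5)}\ \begin{pmatrix}0&0&0\\ d&0&-\frac{k}{2}\\ k&0&m\end{pmatrix}\ (k\neq 0),\quad \text{(6)}\ \begin{pmatrix}0&b&0\\ 0&0&-\frac{k}{2}\\ k&0&m\end{pmatrix}\ (b k\neq 0),$$ $$\text{(7)}\ \begin{pmatrix}0&b&c\\ d&0&\frac{bd}{4c}\\ -\frac{bd}{2c}&-2c&m\end{pmatrix}\ (c\neq 0),\quad \text{(8)}\ \begin{pmatrix}a&-\frac{l^2}{4a}&0\\ \frac{4a^3}{l^2}&-a&0\\ -\frac{4a^2}{l}&l&0\end{pmatrix}\ (a l\neq 0),$$ $$\text{(9)}\ \begin{pmatrix}a&b&c\\ d&a&h\\ -2h&-2c&\frac{bd-a^2-4ch}{2a}\end{pmatrix}\ (a\neq 0),\quad \text{(10)}\ \begin{pmatrix}a&\frac{4c^2g}{(a+g)^2}&c\\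 \frac{a(a+g)^2}{4c^2}&g&\frac{(a+g)^2}{4c}\\ -\frac{a(a+g)}{c}&-\frac{4cg}{a+g}&-a-g\end{pmatrix}\ (c\neq 0,\ a\neq\pm g).$$ Among these operators, the following are strong anti-Rota-Baxter: those of form (1), (2) with $h\ne 0$, (5) with $k\neq 0$, and (6) with $bk\neq 0$.
   Context: $sl_2(\mathbb{C})$ is the complex Lie algebra with basis $e_1,e_2,e_3$ and brackets $[e_1,e_2]=e_3$, $[e_1,e_3]=2e_1$, $[e_2,e_3]=-2e_2$. An anti-Rota-Baxter operator on a Lie algebra $\mathfrak{g}$ is a linear map $R:\mathfrak{g}\to\mathfrak{g}$ with $[R(x),R(y)]=-R([R(x),y]+[x,R(y)])$ for all $x,y\in\mathfrak{g}$. It is called strong if moreover $[[R(x),R(y)],z]+[[R(y),R(z)],x]+[[R(z),R(x)],y]=0$ for all $x,y,z\in\mathfrak{g}$. Matrix convention: the $i$-th row of the matrix $(r_{ij})$ of $R$ lists the coordinates of $R(e_i)$, i.e. $R(e_i)=\sum_{j=1}^3 r_{ij}e_j$. *)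

(* Defs.v *)
From HB Require Import structures.
From mathcomp Require Import all_boot all_order all_algebra.
From mathcomp Require Import ring complex.
From mathcomp Require Import reals.
Set Implicit Arguments.
Unset Strict Implicit.
Unset Printing Implicit Defensive.
Import GRing.Theory.
Local Open Scope ring_scope.

HB.mixin Record Lmodule_isLieAlgebra (K : nzRingType) L & GRing.Lmodule K L := {
  lie : L -> L -> L;
  lie_linearl : forall (a : K) (x y z : L),
    lie (a *: x + y) z = a *: lie x z + lie y z;
  lie_linearr : forall (a : K) (x y z : L),
    lie z (a *: x + y) = a *: lie z x + lie z y;
  liexx : forall x : L, lie x x = 0;
  lie_jacobi : forall x y z : L,
    lie x (lie y z) + lie y (lie z x) + lie z (lie x y) = 0
}.

#[short(type="lieAlgType")]
HB.structure Definition LieAlgebra (K : nzRingType) :=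
  { L of Lmodule_isLieAlgebra K L & GRing.Lmodule K L }.

Notation "[lie x , y ]" := (lie x y)
  (at level 0, x, y at level 99, format "[lie  x ,  y ]") : ring_scope.

Section AntiRotaBaxter.
Variables (K : nzRingType) (L : lieAlgType K).

Definition anti_Rota_Baxter (R : {linear L -> L}) : Prop :=
  forall x y : L, [lie R x, R y] = - R ([lie R x, y] + [lie x, R y]).

Definition strong_anti_Rota_Baxter (R : {linear L -> L}) : Prop :=
  anti_Rota_Baxter R /\
  forall x y z : L,
    [lie [lie R x, R y], z] + [lie [lie R y, R z], x]
      + [lie [lie R z, R x], y] = 0.

End AntiRotaBaxter.

(* The vector space underlying sl_2 is the space of coordinate rows in the
   basis (e_1, e_2, e_3); the bracket is the bilinear alternating extension of
   [e_1, e_2] = e_3, [e_1, e_3] = 2 e_1, [e_2, e_3] = -2 e_2.  Since vectors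
   are rows, the matrix whose i-th row lists the coordinates of R e_i is
   [lin1_mx R]; see [sl2_matrixE]. *)
Definition sl2 (K : fieldType) : Type := 'rV[K]_3.

Section Sl2.
Variable K : fieldType.

HB.instance Definition _ := GRing.Lmodule.copy (sl2 K) 'rV[K]_3.

Definition e1 : sl2 K := delta_mx 0 0.
Definition e2 : sl2 K := delta_mx 0 1.
Definition e3 : sl2 K := delta_mx 0 2.

Definition sl2_lie (x y : sl2 K) : sl2 K :=
  let p (i j : 'I_3) := x 0 i * y 0 j - x 0 j * y 0 i in
  p 0 1 *: e3 + p 0 2 *: (2 *: e1) + p 1 2 *: (- 2 *: e2).

Let sl2_lieE (x y : sl2 K) :
  ((sl2_lie x y 0 0 = 2 * (x 0 0 * y 0 2 - x 0 2 * y 0 0))%R *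
   (sl2_lie x y 0 1 = - 2 * (x 0 1 * y 0 2 - x 0 2 * y 0 1))%R *
   (sl2_lie x y 0 2 = x 0 0 * y 0 1 - x 0 1 * y 0 0)%R)%type.
Proof. by do !split; rewrite !mxE /=; ring. Qed.

Let sl2P (x y : sl2 K) :
  x 0 0 = y 0 0 -> x 0 1 = y 0 1 -> x 0 2 = y 0 2 -> x = y.
Proof.
move=> h0 h1 h2; apply/rowP => -[[|[|[|//]]] hi].
- by rewrite [Ordinal _](_ : _ = 0) //; apply: val_inj.
- by rewrite [Ordinal _](_ : _ = 1) //; apply: val_inj.
- by rewrite [Ordinal _](_ : _ = 2) //; apply: val_inj.
Qed.

Let sl2DE (x y : sl2 K) i : (x + y) 0 i = x 0 i + y 0 i.
Proof. exact: mxE. Qed.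

Let sl2ZE (a : K) (x : sl2 K) i : (a *: x) 0 i = a * x 0 i.
Proof. exact: mxE. Qed.

Let sl20E i : (0 : sl2 K) 0 i = 0.
Proof. exact: mxE. Qed.

Let sl2_linearl (a : K) (x y z : sl2 K) :
  sl2_lie (a *: x + y) z = a *: sl2_lie x z + sl2_lie y z.
Proof.
by apply: sl2P; rewrite !(sl2_lieE, sl2DE, sl2ZE); ring.
Qed.

Let sl2_linearr (a : K) (x y z : sl2 K) :
  sl2_lie z (a *: x + y) = a *: sl2_lie z x + sl2_lie z y.
Proof.
by apply: sl2P; rewrite !(sl2_lieE, sl2DE, sl2ZE); ring.
Qed.

Let sl2_liexx (x : sl2 K) : sl2_lie x x = 0.
Proof. by apply: sl2P; rewrite !(sl2_lieE, sl20E); ring. Qed.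

Let sl2_jacobi (x y z : sl2 K) :
  sl2_lie x (sl2_lie y z) + sl2_lie y (sl2_lie z x)
    + sl2_lie z (sl2_lie x y) = 0.
Proof.
by apply: sl2P; rewrite !(sl2_lieE, sl2DE, sl20E); ring.
Qed.

HB.instance Definition _ := Lmodule_isLieAlgebra.Build K (sl2 K)
  sl2_linearl sl2_linearr sl2_liexx sl2_jacobi.

Lemma sl2_e1e2 : [lie e1, e2] = e3.
Proof. by apply: sl2P; rewrite !(sl2_lieE, sl2ZE) !mxE /=; ring. Qed.

Lemma sl2_e1e3 : [lie e1, e3] = 2 *: e1.
Proof. by apply: sl2P; rewrite !(sl2_lieE, sl2ZE) !mxE /=; ring. Qed.

Lemma sl2_e2e3 : [lie e2, e3] = - 2 *: e2.
Proof. by apply: sl2P; rewrite !(sl2_lieE, sl2ZE) !mxE /=; ring. Qed.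

Lemma sl2_matrixE (R : {linear sl2 K -> sl2 K}) (i : 'I_3) :
  R (delta_mx 0 i) = \sum_(j < 3) lin1_mx R i j *: (delta_mx 0 j : sl2 K).
Proof.
by rewrite [LHS]row_sum_delta; apply: eq_bigr => j _; rewrite mxE.
Qed.

Definition mx3 (a b c d g h k l m : K) : 'M[K]_3 :=
  \matrix_(i < 3, j < 3)
    (nth [::] [:: [:: a; b; c]; [:: d; g; h]; [:: k; l; m]] i)`_j.

Definition form1 (M : 'M[K]_3) : Prop := exists d m : K,
  M = mx3 0 0 0
          d 0 0
          0 0 m.

Definition form2 (M : 'M[K]_3) : Prop := exists d h : K, h != 0 /\
  M = mx3 0 0 0
          d 0 h
          0 0 0.

Definition form3 (M : 'M[K]_3) : Prop := exists b c : K, c != 0 /\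
  M = mx3 0 b c
          0 0 0
          0 0 0.

Definition form4 (M : 'M[K]_3) : Prop := exists b m : K, b != 0 /\
  M = mx3 0 b 0
          0 0 0
          0 0 m.

Definition form5 (M : 'M[K]_3) : Prop := exists d k m : K, k != 0 /\
  M = mx3 0 0 0
          d 0 (- (k / 2))
          k 0 m.

Definition form6 (M : 'M[K]_3) : Prop := exists b k m : K, b * k != 0 /\
  M = mx3 0 b 0
          0 0 (- (k / 2))
          k 0 m.

Definition form7 (M : 'M[K]_3) : Prop := exists b c d m : K, c != 0 /\
  M = mx3 0                         b         c
          d                         0         (b * d / (4 * c))
          (- (b * d / (2 * c)))     (- 2 * c) m.

Definition form8 (M : 'M[K]_3) : Prop := exists a l : K, a * l != 0 /\
  M = mx3 a                         (- (l ^+ 2 / (4 * a))) 0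
          (4 * a ^+ 3 / l ^+ 2)     (- a)                  0
          (- (4 * a ^+ 2 / l))      l                      0.

Definition form9 (M : 'M[K]_3) : Prop := exists a b c d h : K, a != 0 /\
  M = mx3 a         b         c
          d         a         h
          (- 2 * h) (- 2 * c) ((b * d - a ^+ 2 - 4 * c * h) / (2 * a)).

Definition form10 (M : 'M[K]_3) : Prop := exists a c g : K,
  [/\ c != 0, a != g, a != - g &
  M = mx3 a
          (4 * c ^+ 2 * g / (a + g) ^+ 2)
          c
          (a * (a + g) ^+ 2 / (4 * c ^+ 2))
          g
          ((a + g) ^+ 2 / (4 * c))
          (- (a * (a + g) / c))
          (- (4 * c * g / (a + g)))
          (- a - g)].

End Sl2.

(* Main.v *)
Require Import Defs.
From mathcomp Require Import all_boot all_order all_algebra ring complex reals.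
Import GRing.Theory.
Local Open Scope ring_scope.
Local Open Scope complex_scope.

(* Put [u = l + 2 c], [w = k + 2 h] and [s = a - g].  Modulo the nine quadratic
   equations that express the anti-Rota-Baxter identity on the basis,
     [2 b s = - l u], [2 d s = k w], [s k = 2 a w], [s l = - 2 g u],
     [u (a + m) = b w], [w (g + m) = d u].
   If [s = 0], these equations factor and give forms (1)-(7) and (9).  If
   [s != 0], they express [b, c, d, h, k, l] in terms of [a, g, u, w]; the
   remaining ones would give [s ^+ 2 = 0] if [u w = 0]; so [u w != 0], whence
   [u w = - s ^+ 2] and [m = - a - g], and this is form (8) when [a + g = 0] and
   form (10) otherwise. *)

Section AntiRotaBaxterSl2.
Local Set Implicit Arguments.
Local Unset Strict Implicit.
Variable K : fieldType.
Implicit Types (x y : sl2 K) (f : {linear sl2 K -> sl2 K}).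

(** * Coordinates in $sl_2$ and entries of 3 by 3 matrices *)

Lemma forall_ord3 (P : 'I_3 -> Prop) : P 0 -> P 1 -> P 2 -> forall i, P i.
Proof.
move=> P0 P1 P2 [[|[|[|//]]] lti].
- by rewrite [Ordinal _](_ : _ = 0) //; apply: val_inj.
- by rewrite [Ordinal _](_ : _ = 1) //; apply: val_inj.
- by rewrite [Ordinal _](_ : _ = 2) //; apply: val_inj.
Qed.

Lemma sl2P x y :
  x 0 0 = y 0 0 -> x 0 1 = y 0 1 -> x 0 2 = y 0 2 -> x = y.
Proof.
move=> eq0 eq1 eq2; apply/rowP.
exact: (@forall_ord3 (fun i => x 0 i = y 0 i)).
Qed.

Lemma sl2_lieE x y :
  (([lie x, y] 0 0 = 2 * (x 0 0 * y 0 2 - x 0 2 * y 0 0))%R *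
   ([lie x, y] 0 1 = - 2 * (x 0 1 * y 0 2 - x 0 2 * y 0 1))%R *
   ([lie x, y] 0 2 = x 0 0 * y 0 1 - x 0 1 * y 0 0)%R)%type.
Proof. by do !split; rewrite !mxE /=; ring. Qed.

Lemma sl2DE x y i : (x + y) 0 i = x 0 i + y 0 i.
Proof. exact: mxE. Qed.

Lemma sl2NE x i : (- x) 0 i = - x 0 i.
Proof. exact: mxE. Qed.

Lemma sl20E i : (0 : sl2 K) 0 i = 0.
Proof. exact: mxE. Qed.

Lemma sl2_linE f x i :
  f x 0 i = x 0 0 * lin1_mx f 0 i + x 0 1 * lin1_mx f 1 i
            + x 0 2 * lin1_mx f 2 i.
Proof.
rewrite -(mul_rV_lin1 f) mxE !big_ord_recl big_ord0 addr0 addrA.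
by congr (_ * lin1_mx f _ _ + _ * lin1_mx f _ _ + _ * lin1_mx f _ _);
  try congr (x 0 _); apply: val_inj.
Qed.

Lemma e1E : ((e1 K 0 0 = 1)%R * (e1 K 0 1 = 0)%R * (e1 K 0 2 = 0)%R)%type.
Proof. by rewrite !mxE. Qed.

Lemma e2E : ((e2 K 0 0 = 0)%R * (e2 K 0 1 = 1)%R * (e2 K 0 2 = 0)%R)%type.
Proof. by rewrite !mxE. Qed.

Lemma e3E : ((e3 K 0 0 = 0)%R * (e3 K 0 1 = 0)%R * (e3 K 0 2 = 1)%R)%type.
Proof. by rewrite !mxE. Qed.

Lemma mx3E (a b c d g h k l m : K) (A := mx3 a b c d g h k l m) :
  ((A 0 0 = a) * (A 0 1 = b) * (A 0 2 = c) *
   (A 1 0 = d) * (A 1 1 = g) * (A 1 2 = h) *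
   (A 2 0 = k) * (A 2 1 = l) * (A 2 2 = m))%type.
Proof. by rewrite !mxE. Qed.

Lemma mx3_eta (A : 'M[K]_3) :
  A = mx3 (A 0 0) (A 0 1) (A 0 2)
          (A 1 0) (A 1 1) (A 1 2)
          (A 2 0) (A 2 1) (A 2 2).
Proof.
apply/matrixP.
by apply: forall_ord3; apply: forall_ord3; rewrite mx3E.
Qed.

(** * The quadratic equations on the matrix entries *)

Definition aRB_equations (a b c d g h k l m : K) : Prop :=
  [/\ [/\ 4 * a * h + a * k + g * k = 0,
          a * l + 4 * c * g + g * l = 0 &
          a * g + a * m - b * d + 4 * c * h + g * m = 0],
      [/\ 2 * a ^+ 2 + 4 * a * m - 2 * b * d - 2 * c * k + k * l = 0,
          2 * b * (a - g) + l * (l + 2 * c) = 0 &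
          (l + 2 * c) * (a + m) - b * (k + 2 * h) = 0] &
      [/\ 2 * d * (a - g) - k * (k + 2 * h) = 0,
          2 * b * d - 2 * g ^+ 2 - 4 * g * m + 2 * h * l - k * l = 0 &
          d * (l + 2 * c) - (k + 2 * h) * (g + m) = 0]].

(** The defect [D] of the identity is bilinear and alternating in [x] and [y], so the pairs
    $(e_1,e_2)$, $(e_1,e_3)$, $(e_2,e_3)$ carry all its information. Each triple of equations lists
    the three coordinates of [D] at one pair, regrouped where possible around [a - g], [l + 2 * c]
    and [k + 2 * h]. *)
Lemma anti_Rota_Baxter_equations f (A := lin1_mx f) :
  anti_Rota_Baxter f ->
  aRB_equations (A 0 0) (A 0 1) (A 0 2)
                (A 1 0) (A 1 1) (A 1 2)
                (A 2 0) (A 2 1) (A 2 2).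
Proof.
move=> aRB.
pose D x y i := [lie f x, f y] 0 i + f ([lie f x, y] + [lie x, f y]) 0 i.
have D0 x y i : D x y i = 0 by rewrite /D aRB sl2NE addNr.
have DE := (sl2_linE, sl2_lieE, sl2DE, e1E, e2E, e3E).
split; split.
- by rewrite -(D0 (e1 K) (e2 K) 0) /D !DE -/A; ring.
- by rewrite -(D0 (e1 K) (e2 K) 1) /D !DE -/A; ring.
- by rewrite -(D0 (e1 K) (e2 K) 2) /D !DE -/A; ring.
- by rewrite -(D0 (e1 K) (e3 K) 0) /D !DE -/A; ring.
- by rewrite -(D0 (e1 K) (e3 K) 1) /D !DE -/A; ring.
- by rewrite -(D0 (e1 K) (e3 K) 2) /D !DE -/A; ring.
- by rewrite -(D0 (e2 K) (e3 K) 0) /D !DE -/A; ring.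
- by rewrite -(D0 (e2 K) (e3 K) 1) /D !DE -/A; ring.
- by rewrite -(D0 (e2 K) (e3 K) 2) /D !DE -/A; ring.
Qed.

(** * Classification in characteristic different from 2 *)

Hypothesis nz2 : 2 != 0 :> K.

Lemma mulf0r (x y : K) : x * y = 0 -> x != 0 -> y = 0.
Proof. by move=> xy0 nzx; apply: (mulfI nzx); rewrite mulr0. Qed.

Lemma aRB_equations_forms (a b c d g h k l m : K)
    (M := mx3 a b c d g h k l m) :
  aRB_equations a b c d g h k l m ->
  form1 M \/ form2 M \/ form3 M \/ form4 M \/ form5 M \/ form6 M \/
  form7 M \/ form8 M \/ form9 M \/ form10 M.
Proof.
move=> [[E1 E2 E3] [E4 E5 E6] [E7 E8 E9]].
have nz4 : 4 != 0 :> K by rewrite (natrM _ 2 2) mulf_neq0.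
pose u := l + 2 * c; pose w := k + 2 * h; pose s := a - g.
have Eaw : 2 * a * w = s * k.
  by apply/subr0_eq; rewrite -E1 /w /s; ring.
have Egu : 2 * g * u = - (s * l).
  by apply/subr0_eq; rewrite -E2 /u /s; ring.
have [s0|nzs] := eqVneq s 0.
  have ga : g = a by apply/esym/subr0_eq.
  move: s0 E1 E2 E3 E4 E5 E6 E7 E8 E9 Eaw Egu; rewrite ga => s0 E1 E2 E3 E4 E5.
  move=> E6 E7 E8 E9 Eaw Egu.
  (* If [a != 0], then [u = w = 0] fixes [k] and [l], and [E3] with [g = a] gives [m]: form (9). *)
  have [a0|nza] := eqVneq a 0; last first.
    have w0 : w = 0.
      by apply: (@mulf0r (2 * a)); rewrite ?mulf_neq0 // Eaw s0 mul0r.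
    have u0 : u = 0.
      by apply: (@mulf0r (2 * a)); rewrite ?mulf_neq0 // Egu s0 mul0r oppr0.
    do 8 right; left; exists a, b, c, d, h; split=> //.
    have Ek : k = - 2 * h by apply/subr0_eq; rewrite -w0 /w; ring.
    have El : l = - 2 * c by apply/subr0_eq; rewrite -u0 /u; ring.
    rewrite /M ga Ek El; congr mx3.
    apply: (mulfI (mulf_neq0 nz2 nza)); apply/subr0_eq; rewrite -E3.
    by field; rewrite nza nz2.
  have kw0 : k * w = 0.
    by apply: oppr_inj; rewrite oppr0 -E7 a0 /w; ring.
  have lu0 : l * u = 0 by rewrite -E5 a0 /u; ring.
  have Ebd : b * d = 4 * c * h.
    by apply/esym/subr0_eq; rewrite -E3 a0; ring.
  (* For [c != 0], the relation [l * u = 0] splits: [l = 0] kills everything but [b] and [c] (form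
     (3)), while [u = 0] gives [l = - 2 * c], and then [E4] determines [k] (form (7)). *)
  have [c0|nzc] := eqVneq c 0; last first.
    have Eh : h = b * d / (4 * c) by rewrite Ebd; field; rewrite nzc nz4.
    have [l0|nzl] := eqVneq l 0.
      have bd0 : b * d = 0.
        by apply: (@mulf0r 2 _ _ nz2); rewrite -E8 a0 l0; ring.
      have h0 : h = 0 by rewrite Eh bd0 mul0r.
      have k0 : k = 0.
        apply: (@mulf0r (- 2 * c)); last by rewrite mulf_neq0 ?oppr_eq0.
        by apply: etrans E4; rewrite a0 l0 -[2 * b * d]mulrA bd0; ring.
      have m0 : m = 0.
        apply: (@mulf0r (2 * c)); last by rewrite mulf_neq0.
        by rewrite -E6 a0 l0 h0 k0; ring.
      have d0 : d = 0.
        apply: (@mulf0r (2 * c)); last by rewrite mulf_neq0.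
        by rewrite -E9 a0 l0 h0 k0; ring.
      do 2 right; left; exists b, c; split=> //.
      by rewrite /M ga a0 l0 h0 k0 m0 d0.
    have u0 : u = 0 by apply: mulf0r lu0 nzl.
    have El : l = - 2 * c by apply/subr0_eq; rewrite -u0 /u; ring.
    have Ek : k = - (b * d / (2 * c)).
      apply: (mulfI (mulf_neq0 nz4 nzc)).
      apply/subr0_eq/oppr_inj; rewrite oppr0 -E4 a0 El.
      by field; rewrite nzc nz2.
    do 6 right; left; exists b, c, d, m; split=> //.
    by rewrite /M ga a0 El -Eh -Ek.
  (* Now [c = 0], so [u = l] and [l * u = 0] reads [l ^+ 2 = 0]. *)
  have l0 : l = 0.
    by apply/eqP; rewrite -sqrf_eq0 -lu0 /u c0; apply/eqP; ring.
  have bd0 : b * d = 0 by rewrite Ebd c0; ring.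
  have bw0 : b * w = 0 by apply: oppr_inj; rewrite oppr0 -E6 a0 c0 l0 /w; ring.
  have wm0 : w * m = 0 by apply: oppr_inj; rewrite oppr0 -E9 a0 c0 l0 /w; ring.
  (* What remains is [b * d = k * w = b * w = w * m = 0]. If [k != 0], then [w = 0]: forms (5) and
     (6). If [k = 0], then [w = 2 * h]: form (2) for [h != 0], forms (1) and (4) for [h = 0]. *)
  have [k0|nzk] := eqVneq k 0; last first.
    have Eh : h = - (k / 2).
      apply: (mulfI nz2); apply/subr0_eq; rewrite -(mulf0r kw0 nzk) /w.
      by field.
    have [b0|nzb] := eqVneq b 0.
      do 4 right; left; exists d, k, m; split=> //.
      by rewrite /M ga a0 b0 c0 l0 -Eh.
    do 5 right; left; exists b, k, m; split; first by rewrite mulf_neq0.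
    by rewrite /M ga a0 c0 l0 (mulf0r bd0 nzb) -Eh.
  have Ew : w = 2 * h by rewrite /w k0 add0r.
  have [h0|nzh] := eqVneq h 0; last first.
    have nzw : w != 0 by rewrite Ew mulf_neq0.
    right; left; exists d, h; split=> //.
    rewrite /M ga a0 c0 l0 k0 (mulf0r wm0 nzw).
    by rewrite (@mulf0r w b) // mulrC.
  have [b0|nzb] := eqVneq b 0.
    by left; exists d, m; rewrite /M ga a0 b0 c0 h0 k0 l0.
  do 3 right; left; exists b, m; split=> //.
  by rewrite /M ga a0 c0 (mulf0r bd0 nzb) h0 k0 l0.
have nzag : a - g != 0 := nzs.
have Ek : k = 2 * a * w / s by rewrite Eaw; field.
have El : l = - (2 * g * u / s) by rewrite Egu; field.
have Ec : c = u * (a + g) / (2 * s).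
  apply: (mulfI nz2); transitivity (u - l); first by rewrite /u; ring.
  by rewrite El /s; field; rewrite nzag nz2.
have Eh : h = - (w * (a + g) / (2 * s)).
  apply: (mulfI nz2); transitivity (w - k); first by rewrite /w; ring.
  by rewrite Ek /s; field; rewrite nzag nz2.
have Eb : b = g * u ^+ 2 / s ^+ 2.
  apply: (mulfI (mulf_neq0 nz2 nzs)); transitivity (- (l * u)).
    by apply/subr0_eq; rewrite -E5 /u /s; ring.
  by rewrite El; field.
have Ed : d = a * w ^+ 2 / s ^+ 2.
  apply: (mulfI (mulf_neq0 nz2 nzs)); transitivity (k * w).
    by apply/subr0_eq; rewrite -E7 /w /s; ring.
  by rewrite Ek; field.
(* Each of [b * d], [c * k], [h * l], [k * l], [c * h] is a multiple of [t], with coefficient a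
   polynomial in [a] and [g]. *)
pose t := u * w / s ^+ 2.
have Eu : u * (a + m - g * t) = 0.
  by rewrite -E6 -/u -/w Eb /t; field.
have Ewm : w * (g + m - a * t) = 0.
  by apply: oppr_inj; rewrite oppr0 -E9 -/u -/w Ed /t; field.
have [uw0|nzuw] := eqVneq (u * w) 0.
  have t0 : t = 0 by rewrite /t uw0 mul0r.
  have bd0 : b * d = 0.
    transitivity (a * g * t ^+ 2); first by rewrite Eb Ed /t; field.
    by rewrite t0; ring.
  have ck0 : c * k = 0.
    transitivity (a * (a + g) * t); first by rewrite Ec Ek /t; field; rewrite ?nz2 nzs.
    by rewrite t0 mulr0.
  have hl0 : h * l = 0.
    transitivity (g * (a + g) * t); first by rewrite Eh El /t; field; rewrite ?nz2 nzs.
    by rewrite t0 mulr0.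
  have kl0 : k * l = 0.
    transitivity (- (4 * a * g) * t); first by rewrite Ek El /t; field.
    by rewrite t0 mulr0.
  have ch0 : c * h = 0.
    transitivity (- ((a + g) ^+ 2 * t / 4)).
      by rewrite Ec Eh /t; field; rewrite ?nz2 ?nz4 nzs.
    by rewrite t0; ring.
  have F3 : a * g + (a + g) * m = 0.
    transitivity (a * g + (a + g) * m - b * d + 4 * (c * h)).
      by rewrite bd0 ch0; ring.
    by rewrite -E3; ring.
  have F4 : a * (a + 2 * m) = 0.
    apply: (@mulf0r 2 _ _ nz2).
    transitivity (2 * (a * (a + 2 * m)) - 2 * (b * d) - 2 * (c * k) + k * l).
      by rewrite bd0 ck0 kl0; ring.
    by rewrite -E4; ring.
  have F8 : g * (g + 2 * m) = 0.
    apply: (@mulf0r (-2)); last by rewrite oppr_eq0.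
    transitivity (- 2 * (g * (g + 2 * m)) + 2 * (b * d) + 2 * (h * l) - k * l).
      by rewrite bd0 hl0 kl0; ring.
    by rewrite -E8; ring.
  (* The left-hand sides satisfy [F4 + F8 - 2 * F3 = (a - g) ^+ 2], as the terms in [m] cancel. *)
  have : s ^+ 2 = 0.
    transitivity (a * (a + 2 * m) + g * (g + 2 * m) - 2 * (a * g + (a + g) * m)).
      by rewrite /s; ring.
    by rewrite F3 F4 F8; ring.
  by move/eqP; rewrite sqrf_eq0 (negPf nzs).
have [nzu nzw] : u != 0 /\ w != 0.
  by move: nzuw; rewrite mulf_eq0 negb_or => /andP[].
(* The second factors in [Eu] and [Ewm] both vanish, and their difference is [s * (1 + t)]. *)
have t1 : t = -1.
  apply: (mulfI nzs).
  have F := mulf0r Eu nzu; have G := mulf0r Ewm nzw.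
  apply/subr0_eq.
  transitivity ((a + m - g * t) - (g + m - a * t)); first by rewrite /s; ring.
  by rewrite F G subr0.
have Em : m = - a - g.
  by apply/subr0_eq; rewrite -(mulf0r Eu nzu) t1; ring.
have Ew : w = - (s ^+ 2 / u).
  by transitivity (t * s ^+ 2 / u); [rewrite /t; field; rewrite nzu nzs | rewrite t1; ring].
have [ag0|nzapg] := eqVneq (a + g) 0.
  have Eg : g = - a by apply/eqP; rewrite -addr_eq0 addrC ag0.
  have Es : s = 2 * a by rewrite /s Eg; ring.
  have nza : a != 0 by apply: contraNneq nzs; rewrite Es => ->; rewrite mulr0.
  (* Since [a + g = 0] forces [c = 0], the parameter [l] of form (8) is [u] itself. *)
  do 7 right; left; exists a, u; split; first exact: mulf_neq0.
  have Elu : l = u by rewrite El Eg Es; field; rewrite nza nz2.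
  rewrite /M; congr mx3 => //.
  - by rewrite Eb Es Eg; field; rewrite nza nz4.
  - by rewrite Ec ag0; ring.
  - by rewrite Ed Ew Es; field; rewrite nza nzu nz2.
  - by rewrite Eh ag0; ring.
  - by rewrite Ek Ew Es; field; rewrite nza nzu nz2.
  - by rewrite Em Eg; ring.
have nzc : c != 0 by rewrite Ec !mulf_neq0 ?invr_eq0 ?mulf_neq0.
do 9 right; exists a, c, g; split=> //.
- by apply: contraNneq nzs => ag; rewrite /s ag subrr.
- by apply: contraNneq nzapg => ->; rewrite addNr.
(* As [a + g != 0], [Ec] can be inverted, and [c] replaces [u] as the free parameter. *)
have Eus : u = 2 * s * c / (a + g) by rewrite Ec; field; rewrite nz2 nzs nzapg.
rewrite /M; congr mx3 => //.
- by rewrite Eb Eus; field; rewrite nzapg nzs.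
- by rewrite Ed Ew Eus; field; rewrite ?nz2 ?nz4 nzc nzs nzapg.
- by rewrite Eh Ew Eus; field; rewrite ?nz2 ?nz4 nzc nzs nzapg.
- by rewrite Ek Ew Eus; field; rewrite ?nz2 ?nz4 nzc nzs nzapg.
- by rewrite El Eus; field; rewrite ?nz2 ?nz4 nzs nzapg.
Qed.

(** * The strong identity *)

Lemma strong_of_products f (b d h k m : K) (w := k + 2 * h) :
  lin1_mx f = mx3 0 b 0
                  d 0 h
                  k 0 m ->
  b * d = 0 -> k * w = 0 -> b * w = 0 -> w * m = 0 ->
  strong_anti_Rota_Baxter f.
Proof.
move=> fE bd0 kw0 bw0 wm0.
have E := (sl2NE, sl20E, sl2_linE f, sl2_lieE, sl2DE).
(* The products leave three linear families: [k = b = m = 0] when [w != 0], and [k = - 2 * h] with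
   [b = 0] or [d = 0] when [w = 0]. On each, both identities are polynomial identities in the
   coordinates of arbitrary vectors. *)
have [w0|nzw] := eqVneq w 0; last first.
  have k0 : k = 0 by apply: (mulIf nzw); rewrite mul0r.
  have b0 : b = 0 by apply: (mulIf nzw); rewrite mul0r.
  have m0 : m = 0 by apply: (mulfI nzw); rewrite mulr0.
  by split=> [x y|x y z]; apply: sl2P; rewrite !E fE !mx3E k0 b0 m0; ring.
have k2h : k = - 2 * h by apply/subr0_eq; rewrite -w0 /w; ring.
have [b0|d0] : b = 0 \/ d = 0.
    by move/eqP: bd0; rewrite mulf_eq0 => /orP[] /eqP; [left|right].
  by split=> [x y|x y z]; apply: sl2P; rewrite !E fE !mx3E k2h b0; ring.
by split=> [x y|x y z]; apply: sl2P; rewrite !E fE !mx3E k2h d0; ring.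
Qed.

(** The four products vanish because [w = 0] in forms (1), (5) and (6), where moreover [b = 0] or
    [d = 0], and because [b = k = m = 0] in form (2). *)
Lemma strong_of_form f (A := lin1_mx f) :
  form1 A \/ form2 A \/ form5 A \/ form6 A -> strong_anti_Rota_Baxter f.
Proof.
case=> [[d [m fE]]|[[d [h [_ fE]]]|[[d [k [m [_ fE]]]]|[b [k [m [_ fE]]]]]]];
  apply: (strong_of_products fE); rewrite ?mul0r ?mulr0 //; by field.
Qed.

End AntiRotaBaxterSl2.

Theorem theorem3p1 (R : realType) :
  (forall f : {linear sl2 R[i] -> sl2 R[i]},
     anti_Rota_Baxter f ->
     form1 (lin1_mx f) \/ form2 (lin1_mx f) \/ form3 (lin1_mx f) \/
     form4 (lin1_mx f) \/ form5 (lin1_mx f) \/ form6 (lin1_mx f) \/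
     form7 (lin1_mx f) \/ form8 (lin1_mx f) \/ form9 (lin1_mx f) \/
     form10 (lin1_mx f)) /\
  (forall f : {linear sl2 R[i] -> sl2 R[i]},
     form1 (lin1_mx f) \/ form2 (lin1_mx f) \/
     form5 (lin1_mx f) \/ form6 (lin1_mx f) ->
     strong_anti_Rota_Baxter f).
Proof.
have nz2 : 2 != 0 :> R[i] by rewrite Num.Theory.pnatr_eq0.
split=> f; last exact: strong_of_form.
move/anti_Rota_Baxter_equations/(aRB_equations_forms nz2).
by rewrite -mx3_eta.
Qed.
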